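(* Suppose that $f$ has the MLR property, i.e. $f(x_1-\eta_1)f(x_2-\eta_2)\ge f(x_1-\eta_2)f(x_2-\eta_1)$ whenever $x_1<x_2$ and $\eta_1<\eta_2$. Consider estimating $\theta_{(2)}$ under the absolute error loss $|a-\theta_{(2)}|$, and let $c_0$ and $c(0,u)$, $u>0$, be such that $$\int_{-\infty}^{c_0}f(z)\,dz=\frac12\qquad\text{and}\qquad \frac{\int_{-\infty}^{c(0,u)}f(z-u)f(z)\,dz}{\int_{-\infty}^{\infty}f(z-u)f(z)\,dz}=\frac12 .$$ If $P_{\boldsymbol\theta}(c_0>c(0,U))\ne0$ for some $\boldsymbol\theta\in\mathbb{R}^2$, then the estimator $\delta_{ST}(\mathbf X)=X_{(2)}-\min\{c_0,c(0,U)\}$ improves upon the estimator $\delta_{c_0}(\mathbf X)=X_{(2)}-c_0$.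
   Context: Setting: $f$ is a Lebesgue probability density on $\mathbb{R}$; $X_1,X_2$ are independent and $X_i$ has density $x\mapsto f(x-\theta_i)$, where $\boldsymbol\theta=(\theta_1,\theta_2)\in\mathbb{R}^2$ is unknown. Write $\theta_{(2)}=\max\{\theta_1,\theta_2\}$, $X_{(1)}=\min\{X_1,X_2\}$, $X_{(2)}=\max\{X_1,X_2\}$, $U=X_{(2)}-X_{(1)}$, $\mathbf X=(X_1,X_2)$. The risk of $\delta$ is $R(\boldsymbol\theta,\delta)=E_{\boldsymbol\theta}|\delta(\mathbf X)-\theta_{(2)}|$. Standing assumptions: all integrals involving the loss are finite (so the risks are finite), and $c_0$ and $c(0,u)$, $u>0$, are well defined, i.e. are the unique solutions of their defining equations (in particular $\int f(z-u)f(z)\,dz>0$). ''$\delta'$ improves upon $\delta$'' means $R(\boldsymbol\theta,\delta')\le R(\boldsymbol\theta,\delta)$ for all $\boldsymbol\theta\in\mathbb{R}^2$, with strict inequality for some $\boldsymbol\theta$. *)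

(* Defs.v *)
From HB Require Import structures.
From mathcomp Require Export all_boot all_order all_algebra.
From mathcomp Require Export all_classical all_reals all_analysis.
Export Order.TTheory GRing.Theory Num.Theory.
Export numFieldNormedType.Exports.

Set Implicit Arguments.
Unset Strict Implicit.
Unset Printing Implicit Defensive.

Local Open Scope classical_set_scope.
Local Open Scope ring_scope.

Definition is_lebesgue_density (R : realType) (f : R -> R) : Prop :=
  [/\ measurable_fun setT f, (forall x, 0 <= f x) &
      (\int[lebesgue_measure]_x (f x)%:E = 1)%E].

Definition MLR (R : realType) (f : R -> R) : Prop :=
  forall x1 x2 eta1 eta2 : R, x1 < x2 -> eta1 < eta2 ->
    f (x1 - eta2) * f (x2 - eta1) <= f (x1 - eta1) * f (x2 - eta2).

Definition has_density d (T : measurableType d) (R : realType)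
    (P : probability T R) (X : {mfun T >-> R}) (g : R -> R) : Prop :=
  forall A : set R, measurable A ->
    distribution P X A = (\int[lebesgue_measure]_(x in A) (g x)%:E)%E.

Definition independent_RV2 d (T : measurableType d) (R : realType)
    (P : probability T R) (X1 X2 : {mfun T >-> R}) : Prop :=
  forall A B : set R, measurable A -> measurable B ->
    P (X1 @^-1` A `&` X2 @^-1` B) = (P (X1 @^-1` A) * P (X2 @^-1` B))%E.

(* A single sample space carries all the laws [P theta], so that [X1] and [X2]
   do not depend on the parameter. *)
Definition location_model d (T : measurableType d) (R : realType) (f : R -> R)
    (P : R * R -> probability T R) (X1 X2 : {mfun T >-> R}) : Prop :=
  forall theta : R * R,
    [/\ has_density (P theta) X1 (fun x => f (x - theta.1)),
        has_density (P theta) X2 (fun x => f (x - theta.2)) &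
        independent_RV2 (P theta) X1 X2].

(* [x.1] and [x.2] are the unordered observations; [ordmin] and [ordmax] give
   the order statistics X_(1) and X_(2), and [ordmax theta] is theta_(2). *)
Definition ordmin (R : realType) (x : R * R) : R := Num.min x.1 x.2.
Definition ordmax (R : realType) (x : R * R) : R := Num.max x.1 x.2.
Definition spacing (R : realType) (x : R * R) : R := ordmax x - ordmin x.

Definition risk d (T : measurableType d) (R : realType)
    (P : R * R -> probability T R) (X1 X2 : {mfun T >-> R})
    (theta : R * R) (delta : R * R -> R) : \bar R :=
  ('E_(P theta)[fun w => `|delta (X1 w, X2 w) - ordmax theta|%R])%E.

Definition improves_upon d (T : measurableType d) (R : realType)
    (P : R * R -> probability T R) (X1 X2 : {mfun T >-> R})
    (delta' delta : R * R -> R) : Prop :=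
  (forall theta, (risk P X1 X2 theta delta' <= risk P X1 X2 theta delta)%E) /\
  (exists theta, (risk P X1 X2 theta delta' < risk P X1 X2 theta delta)%E).

Definition c0_eq (R : realType) (f : R -> R) (c : R) : Prop :=
  \int[lebesgue_measure]_(z in `]-oo, c]) f z = 1 / 2.

(* The integrals are real-valued: an infinite one counts as 0 and x / 0 = 0, so
   the equation can only hold if the denominator is finite and positive. *)
Definition c0u_eq (R : realType) (f : R -> R) (u c : R) : Prop :=
  (\int[lebesgue_measure]_(z in `]-oo, c]) (f (z - u) * f z)) /
  (\int[lebesgue_measure]_z (f (z - u) * f z)) = 1 / 2.

Definition delta_loc (R : realType) (c0 : R) (x : R * R) : R := ordmax x - c0.

Definition delta_ST (R : realType) (c0 : R) (c : R -> R) (x : R * R) : R :=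
  ordmax x - Num.min c0 (c (spacing x)).

(* Main.v *)
(** Put [l = |theta_1 - theta_2|] and [z = X_(2) - theta_(2)].  Given [U = u],
    the density of [z] is proportional to
    [f (z - u + l) f z + f (z + l) f (z - u)], and MLR makes its ratio to the
    [l = 0] density [f (z - u) f z] nonincreasing in [z].  Hence the median
    [c(0,u)] at [l = 0] has at least half of the mass on its left for every [l],
    so moving the subtracted constant from [c_0] down to [c(0,u)] when
    [c(0,u) < c_0] cannot increase the conditional risk.  At
    [theta_1 = theta_2] the decrease is strict, because the median is unique;
    and [U] has an absolutely continuous law for every [theta], so the event
    [c(0,U) < c_0], not null for some [theta], yields a set of [u] of positive
    Lebesgue measure. *)

From HB Require Import structures.
Require Import Defs.
From mathcomp Require Import measurable_realfun ring lra.

Set Implicit Arguments.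
Unset Strict Implicit.
Unset Printing Implicit Defensive.

Local Open Scope classical_set_scope.
Local Open Scope ring_scope.

(** * Change of variables for Lebesgue integrals on the line and in the plane *)

Section Lebesgue_change_of_variable.
Local Open Scope ereal_scope.
Context {R : realType}.
Local Notation mu := (@lebesgue_measure R).

(** Translation preserves the length of half-open intervals, and these lengths determine the
    Lebesgue measure. *)
Lemma lebesgue_measureD (a : R) (A : set R) : measurable A ->
  pushforward mu (+%R^~ a : _ -> measurableTypeR R) A = mu A.
Proof.
pose shift : measurableTypeR R -> measurableTypeR R := +%R^~ a.
move=> mA; have mshift : measurable_fun setT shift by exact: measurable_funD.
pose phi : {mfun _ >-> measurableTypeR R} :=
  HB.pack shift (isMeasurableFun.Build _ _ _ _ _ mshift).
apply/esym/(@lebesgue_measure_unique _ (pushforward mu phi)) => //=.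
move=> _ [[b c]] _ <-.
rewrite /pushforward/=.
have -> : +%R^~ a @^-1` `]b, c]%classic = `](b - a)%R, (c - a)%R]%classic.
  by apply/seteqP; split => x /=; rewrite !in_itv/= ltrBlDr lerBrDr.
rewrite !lebesgue_measure_itv/= !lte_fin ltrD2r; case: ifPn => // _.
by rewrite -!EFinB; congr (_%:E); rewrite opprB addrA subrK.
Qed.

Lemma ge0_integralT_translation (a : R) (g : R -> \bar R) :
  measurable_fun setT g -> (forall x, 0 <= g x) ->
  \int[mu]_x g (x + a)%R = \int[mu]_x g x.
Proof.
move=> mg g0.
transitivity (\int[pushforward mu (+%R^~ a : _ -> measurableTypeR R)]_x g x).
  by rewrite ge0_integral_pushforward//; exact: measurable_funD.
apply: (eq_measure_integral mu) => [|m A mA _]; last exact: lebesgue_measureD.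
exact: measurable_funD.
Qed.

Lemma ge0_integralN_oppr (g : R -> \bar R) :
  measurable_fun setT g -> (forall x, 0 <= g x) ->
  \int[mu]_(x in `]-oo, 0%R[) g x = \int[mu]_(x in `]0%R, +oo[) g (- x)%R.
Proof.
move=> mg g0.
pose nu := pushforward mu (-%R : _ -> measurableTypeR R).
transitivity (\int[nu]_(x in `]-oo, 0%R[) g x).
  by apply: (eq_measure_integral nu) => A mA _; exact/esym/lebesgue_measureN.
rewrite ge0_integral_pushforward//; last exact: measurable_funS mg.
by congr integral; apply/seteqP; split => x /=; rewrite !in_itv/= andbT oppr_lt0.
Qed.

Lemma ge0_integral_setT_split0 (g : R -> \bar R) :
  measurable_fun setT g -> (forall x, 0 <= g x) ->
  \int[mu]_x g x = \int[mu]_(u in `]0%R, +oo[) (g u + g (- u)%R).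
Proof.
move=> mg g0.
rewrite ge0_integralD//; last 2 first.
- exact: measurable_funTS.
- by apply: measurable_funTS; exact: measurableT_comp.
rewrite -ge0_integralN_oppr//.
have -> : [set: R] = `]-oo, 0%R[ `|` `[0%R, +oo[.
  apply/seteqP; split => x //= _; rewrite !in_itv/= andbT.
  by case: (ltP x 0%R) => _; [left|right].
rewrite ge0_integral_setU//=.
- by rewrite addeC integral_itv_obnd_cbnd//; exact: measurable_funTS.
- exact: measurable_funTS.
- by apply/disj_setPS => x /= []; rewrite !in_itv/= andbT ltNge => /negP.
Qed.

(** Substitute [y = x + u], exchange the integrals by Tonelli, and fold [u < 0] onto [u > 0]. In
    both resulting summands [z] is the larger coordinate and [u] the gap; the summands differ in
    which coordinate is the larger. *)
Lemma ge0_integral2_location_spacing (H : R * R -> \bar R) :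
  measurable_fun setT H -> (forall p, 0 <= H p) ->
  \int[mu]_x \int[mu]_y H (x, y) =
  \int[mu]_(u in `]0%R, +oo[) \int[mu]_z (H ((z - u)%R, z) + H (z, (z - u)%R)).
Proof.
move=> mH H0.
have mH1 d (T : measurableType d) (q : T -> R * R) :
    measurable_fun setT q -> measurable_fun setT (H \o q).
  by move=> ?; exact: measurableT_comp.
have mq1 : measurable_fun setT (fun p : R * R => (p.1, (p.2 + p.1)%R)).
  by apply: measurable_fun_pair => //; exact: measurable_funD.
have mq2 (u : R) : measurable_fun setT (fun z : R => ((z - u)%R, z)).
  by apply: measurable_fun_pair => //; exact: measurable_funB.
have mq3 (u : R) : measurable_fun setT (fun z : R => (z, (z - u)%R)).
  by apply: measurable_fun_pair => //; exact: measurable_funB.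
have mq4 (x : R) : measurable_fun setT (fun y : R => (x, y)).
  by apply: measurable_fun_pair => //; exact: measurable_funB.
pose H' (p : R * R) := H (p.1, (p.2 + p.1)%R).
have mH' : measurable_fun setT H' by exact: mH1.
have H'0 p : 0 <= H' p by exact: H0.
transitivity (\int[mu]_x \int[mu]_u H' (x, u)).
  apply: eq_integral => x _.
  by rewrite -[LHS](ge0_integralT_translation x)//; exact: (mH1 _ _ _ (mq4 x)).
transitivity (\int[mu]_u \int[mu]_x H' (x, u)).
  exact: (@fubini_tonelli _ _ _ _ R mu mu H' mH' H'0).
rewrite ge0_integral_setT_split0; last 2 first.
- exact: (@measurable_fun_fubini_tonelli_G _ _ _ _ R mu H' mH' H'0).
- by move=> u; apply: integral_ge0.
apply: eq_integral => u _.
rewrite ge0_integralD//; last 2 first.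
- exact: (mH1 _ _ _ (mq2 u)).
- exact: (mH1 _ _ _ (mq3 u)).
congr (_ + _); last by apply: eq_integral => x _; rewrite /H'/= (addrC (- u)%R).
rewrite -[in RHS](ge0_integralT_translation u)//; last first.
  exact: (mH1 _ _ _ (mq2 u)).
by apply: eq_integral => x _; rewrite /H'/= addrK addrC.
Qed.

End Lebesgue_change_of_variable.

(** * Expectations under laws with densities and under independence *)

Lemma ge0_integral_density d (T : measurableType d) (R : realType)
    (nu : {finite_measure set T -> \bar R})
    (mu : {sigma_finite_measure set T -> \bar R}) (g : T -> \bar R) :
  measurable_fun setT g -> (forall x, 0 <= g x)%E ->
  (forall A, measurable A -> nu A = \int[mu]_(x in A) g x)%E ->
  forall F : T -> \bar R, measurable_fun setT F -> (forall x, 0 <= F x)%E ->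
  (\int[nu]_x F x = \int[mu]_x (F x * g x))%E.
Proof.
move=> mg g0 nuE F mF F0.
have numu : nu `<< mu.
  apply/null_content_dominatesP => A mA muA0; rewrite nuE//.
  by apply: null_set_integral => //; exact: measurable_funTS.
rewrite -(Radon_Nikodym_SigmaFinite.change_of_variables numu)//.
have iRN := Radon_Nikodym_SigmaFinite.f_integrable numu.
have mRN := measurable_int _ iRN.
apply: ge0_ae_eq_integral => //.
- exact: emeasurable_funM.
- exact: emeasurable_funM.
- by move=> x _; rewrite mule_ge0// Radon_Nikodym_SigmaFinite.f_ge0.
- by move=> x _; rewrite mule_ge0.
(* The Radon-Nikodym derivative and [g] have the same integral over every measurable set, hence
   agree almost everywhere. *)
- apply: ae_eqe_mul2l; apply: integral_ae_eq => // E _ mE.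
  by rewrite -nuE// -Radon_Nikodym_SigmaFinite.f_integral.
Qed.

Lemma ge0_integral_has_density d (T : measurableType d) (R : realType)
    (P : probability T R) (X : {mfun T >-> R}) (g : R -> R) :
  measurable_fun setT g -> (forall x, 0 <= g x) -> has_density P X g ->
  forall F : R -> \bar R, measurable_fun setT F -> (forall x, 0 <= F x)%E ->
  (\int[distribution P X]_x F x =
   \int[lebesgue_measure]_x (F x * (g x)%:E))%E.
Proof.
move=> mg g0 dX F mF F0.
(* [lebesgue_measure] lives on [measurableTypeR R], so [X] is repackaged as a map into that type. *)
have mX : measurable_fun setT (X : T -> measurableTypeR R).
  exact: (measurable_funPT X).
pose X' : {mfun T >-> measurableTypeR R} :=
  HB.pack (X : T -> measurableTypeR R) (isMeasurableFun.Build _ _ _ _ _ mX).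
pose nu : probability (measurableTypeR R) R := distribution P X'.
transitivity (\int[nu]_x F x)%E.
  by rewrite !ge0_integral_distribution.
apply: (@ge0_integral_density _ (measurableTypeR R) R nu lebesgue_measure
  (EFin \o g)) => //.
exact/measurable_EFinP.
Qed.

(** Independence makes the joint law agree with the product of the marginals on rectangles, hence
    everywhere. Tonelli then lets each marginal be replaced by its density in turn. *)
Lemma ge0_integral_independent2 d (T : measurableType d) (R : realType)
    (P : probability T R) (X1 X2 : {mfun T >-> R}) (g1 g2 : R -> R) :
  measurable_fun setT g1 -> (forall x, 0 <= g1 x) ->
  measurable_fun setT g2 -> (forall x, 0 <= g2 x) ->
  has_density P X1 g1 -> has_density P X2 g2 -> independent_RV2 P X1 X2 ->
  forall F : R * R -> \bar R, measurable_fun setT F ->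
  (forall p, 0 <= F p)%E ->
  (\int[P]_w F (X1 w, X2 w) =
   \int[lebesgue_measure]_x \int[lebesgue_measure]_y
     (F (x, y) * (g1 x * g2 y)%:E))%E.
Proof.
move=> mg1 g10 mg2 g20 dX1 dX2 indep F mF F0.
have mX : measurable_fun setT (fun w => (X1 w, X2 w)).
  exact: measurable_fun_pair.
pose X : {mfun T >-> (R * R)%type} :=
  HB.pack (fun w => (X1 w, X2 w)) (isMeasurableFun.Build _ _ _ _ _ mX).
pose nu1 : probability R R := distribution P X1.
pose nu2 : probability R R := distribution P X2.
transitivity (\int[distribution P X]_p F p)%E.
  by rewrite ge0_integral_distribution.
transitivity (\int[nu1 \x nu2]_p F p)%E.
  apply: (eq_measure_integral (nu1 \x nu2)%E) => A mA _.
  apply/esym/product_measure_unique; last exact: mA.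
  move=> B C mB mC.
  exact: (indep B C mB mC).
rewrite fubini_tonelli1//.
have mF2 : measurable_fun setT (fubini_F nu2 F).
  exact: measurable_fun_fubini_tonelli_F.
have fubini_FE x : fubini_F nu2 F x =
    (\int[lebesgue_measure]_y (F (x, y) * (g2 y)%:E))%E.
  rewrite /fubini_F (ge0_integral_has_density mg2 g20 dX2)//.
  exact: measurable_fun_pair2.
rewrite (ge0_integral_has_density mg1 g10 dX1)//; last first.
  by move=> x; apply: integral_ge0.
apply: eq_integral => x _; rewrite fubini_FE /= -ge0_integralZr//.
- by apply: eq_integral => y _; rewrite EFinM muleAC muleA.
- apply: emeasurable_funM; last exact/measurable_EFinP.
  exact: measurable_fun_pair2.
- by move=> y _; rewrite mule_ge0 ?lee_fin.
- by rewrite lee_fin.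
Qed.

(* For [l = |theta_1 - theta_2|], the density at [(z, u)], [u > 0], of
   [(X_(2) - theta_(2), U)]: one summand for each ordering of [X_1] and [X_2]. *)
Definition spacing_density (R : realType) (f : R -> R) (l u z : R) : R :=
  f (z - u + l) * f z + f (z + l) * f (z - u).

Lemma measurable_ordmax (R : realType) :
  measurable_fun setT (fun x : R * R => ordmax x).
Proof. exact: measurable_maxr. Qed.

Lemma measurable_spacing (R : realType) :
  measurable_fun setT (fun x : R * R => spacing x).
Proof.
by apply: measurable_funB; [exact: measurable_ordmax|exact: measurable_minr].
Qed.

Lemma spacing_ge0 (R : realType) (x : R * R) : 0 <= spacing x.
Proof. by rewrite /spacing /ordmax /ordmin subr_ge0 ge_min le_max lexx. Qed.

(** * The joint law of the centred maximum and the spacing *)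

Section location_model_integral.
Context {R : realType}.
Local Notation mu := (@lebesgue_measure R).

(** The joint density of the observations is rewritten in the coordinates (maximum, spacing), and
    the maximum is then recentred at [ordmax theta]. Afterwards only [|theta.1 - theta.2|] is left
    of the parameter. *)
Lemma ge0_integral_location_model d (T : measurableType d) (f : R -> R)
    (P : R * R -> probability T R) (X1 X2 : {mfun T >-> R}) (theta : R * R)
    (G : R * R -> \bar R) :
  is_lebesgue_density f -> location_model f P X1 X2 ->
  measurable_fun setT G -> (forall p, 0 <= G p)%E ->
  (\int[P theta]_w
     G (ordmax (X1 w, X2 w) - ordmax theta, spacing (X1 w, X2 w))%R =
   \int[mu]_(u in `]0%R, +oo[) \int[mu]_z
     (G (z, u) * (spacing_density f `|theta.1 - theta.2| u z)%:E))%E.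
Proof.
move=> [mf f0 _] model mG G0; have [dX1 dX2 indep] := model theta.
have mfB (a : R) : measurable_fun setT (fun x : R => f (x - a)).
  by apply: measurableT_comp => //; exact: measurable_funB.
pose M (p : R * R) := (ordmax p - ordmax theta, spacing p).
have mM : measurable_fun setT M.
  apply: measurable_fun_pair; last exact: measurable_spacing.
  by apply: measurable_funB => //; exact: measurable_ordmax.
have mGM : measurable_fun setT (G \o M) by exact: measurableT_comp.
pose H (p : R * R) :=
  ((G \o M) p * (f (p.1 - theta.1) * f (p.2 - theta.2))%:E)%E.
have mH : measurable_fun setT H.
  apply: emeasurable_funM => //; apply/measurable_EFinP/measurable_funM.
    exact: measurableT_comp (mfB _) measurable_fst.
  exact: measurableT_comp (mfB _) measurable_snd.
have H0 p : (0 <= H p)%E.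
  by apply: mule_ge0; [exact: G0|rewrite lee_fin mulr_ge0].
transitivity (\int[mu]_x \int[mu]_y H (x, y))%E.
  by apply: (ge0_integral_independent2 (mfB theta.1) _ (mfB theta.2) _ dX1 dX2
    indep mGM) => // p; exact: G0.
rewrite ge0_integral2_location_spacing//.
apply: eq_integral => u; rewrite inE/= in_itv/= andbT => u0.
have HE (z : R) : (H ((z - u)%R, z) + H (z, (z - u)%R) =
    G ((z - ordmax theta)%R, u) *
    (f (z - u - theta.1) * f (z - theta.2) +
     f (z - theta.1) * f (z - u - theta.2))%:E)%E.
  have zu : z - u < z by rewrite ltrBlDr ltrDl.
  rewrite /H /= /M /spacing /ordmax /ordmin /= maxC minC.
  rewrite (max_l (ltW zu)) (min_r (ltW zu)) subKr.
  by rewrite EFinD ge0_muleDr// lee_fin mulr_ge0.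
under eq_integral do rewrite HE.
rewrite -[LHS](ge0_integralT_translation (ordmax theta)); last 2 first.
- apply: emeasurable_funM.
    apply: measurableT_comp => //; apply: measurable_fun_pair => //.
    exact: measurable_funB.
  apply/measurable_EFinP; apply: measurable_funD; apply: measurable_funM => //.
    by under eq_fun do rewrite -addrA -opprD; exact: mfB.
  by under eq_fun do rewrite -addrA -opprD; exact: mfB.
- by move=> z; rewrite mule_ge0// lee_fin addr_ge0 ?mulr_ge0.
apply: eq_integral => z _; rewrite addrK; congr (_ * _%:E)%E.
(* Exchanging the order of the two parameters only swaps the two summands of the density. *)
rewrite /spacing_density /ordmax; case: (leP theta.1 theta.2) => t12.
  rewrite ler0_norm ?subr_le0// addrK opprB.
  by congr (f _ * f _ + f _ * f _); ring.
rewrite gtr0_norm ?subr_gt0// addrK [RHS]addrC mulrC [f z * _]mulrC.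
by congr (f _ * f _ + f _ * f _); ring.
Qed.

End location_model_integral.

(** * Medians of an unnormalised weight and mean absolute deviation *)

Section weighted_median.
Context {R : realType}.
Local Notation mu := (@lebesgue_measure R).
Variable h : R -> R.
Hypotheses (mh : measurable_fun setT h) (h0 : forall z, 0 <= h z).

Lemma ge0_integralT_split_at (c : R) :
  (\int[mu]_z (h z)%:E =
   \int[mu]_(z in `]-oo, c]) (h z)%:E + \int[mu]_(z in `]c, +oo[) (h z)%:E)%E.
Proof.
rewrite -ge0_integral_setU//=.
- by congr integral; apply/seteqP; split => x //= _; rewrite !in_itv/= andbT;
    case: (leP x c) => _; [left|right].
- by apply/measurable_funTS/measurable_EFinP.
- by move=> x _; rewrite lee_fin.
- by apply/disj_setPS => x /= []; rewrite !in_itv/= andbT leNgt => /negP.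
Qed.

Lemma integral_EFin_indic (D : set R) : measurable D ->
  (\int[mu]_(z in D) (h z)%:E = \int[mu]_z (h z * \1_D z)%:E)%E.
Proof.
move=> mD; rewrite integral_mkcond; apply: eq_integral => z _.
by rewrite patchE indicE; case: ifPn => _; rewrite ?mulr1 ?mulr0.
Qed.

Lemma ge0_le_integral_itvNyc (s t : R) : s <= t ->
  (\int[mu]_(z in `]-oo, s]) (h z)%:E <= \int[mu]_(z in `]-oo, t]) (h z)%:E)%E.
Proof.
move=> st; apply: ge0_subset_integral => //.
- by apply/measurable_funTS/measurable_EFinP.
- by move=> x _; rewrite lee_fin.
- by move=> x /=; rewrite !in_itv/= => /le_trans; apply.
Qed.

Lemma ge0_le_integral_itvoy (s t : R) : s <= t ->
  (\int[mu]_(z in `]t, +oo[) (h z)%:E <= \int[mu]_(z in `]s, +oo[) (h z)%:E)%E.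
Proof.
move=> st; apply: ge0_subset_integral => //.
- by apply/measurable_funTS/measurable_EFinP.
- by move=> x _; rewrite lee_fin.
- by move=> x /=; rewrite !in_itv/= !andbT; apply: le_lt_trans.
Qed.

(** A median of the measure with density [h], stated without division. Positivity and finiteness of
    the halves exclude the degenerate total masses 0 and [+oo]. *)
Definition bisects (c : R) : Prop :=
  [/\ (\int[mu]_(z in `]-oo, c]) (h z)%:E = \int[mu]_(z in `]c, +oo[) (h z)%:E)%E,
      (0 < \int[mu]_(z in `]-oo, c]) (h z)%:E)%E &
      (\int[mu]_(z in `]-oo, c]) (h z)%:E < +oo)%E].

Lemma bisectsP (c : R) : bisects c <->
  (\int[mu]_(z in `]-oo, c]) h z) / (\int[mu]_z h z) = 1 / 2.
Proof.
rewrite /bisects /Rintegral.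
have I0 (D : set R) : (0 <= \int[mu]_(z in D) (h z)%:E)%E.
  by apply: integral_ge0 => z _; rewrite lee_fin.
have := ge0_integralT_split_at c.
have := I0 `]-oo, c]%classic; have := I0 `]c, +oo[%classic; have := I0 setT.
case: (\int[mu]_z (h z)%:E)%E => [m| |] //=; last first.
  (* Infinite total mass: the real-valued denominator is 0 and so is the quotient, while [bisects]
     would make both halves finite. *)
  move=> _ _ _ mE; rewrite invr0 mulr0; split => [[e p y]|/esym/eqP].
    by move: mE y; rewrite -e; case: (\int[mu]_(z in `]-oo, c]) (h z)%:E)%E.
  by rewrite mul1r invr_eq0 pnatr_eq0.
case: (\int[mu]_(z in `]c, +oo[) (h z)%:E)%E => [b| |]//=;
  case: (\int[mu]_(z in `]-oo, c]) (h z)%:E)%E => [a| |]//=.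
rewrite !lee_fin => m0 b0 a0 [->]; rewrite !lte_fin ltry; split.
  move=> [[ab] a1 _]; subst b; have a2 : a != 0 by rewrite gt_eqF.
  by rewrite -mulr2n -[a *+ 2]mulr_natr invfM mulrA divff.
move=> e; have ab : a + b != 0.
  apply: contra_eq_neq e => ->; rewrite invr0 mulr0 eq_sym mul1r invr_eq0.
  by rewrite pnatr_eq0.
have {}e : a = b.
  have : a / (a + b) * (a + b) = 1 / 2 * (a + b) by rewrite e.
  by rewrite divfK//; lra.
split => //; first by rewrite e.
by rewrite lt0r a0 andbT; apply: contra_neq ab => a00; rewrite -e a00 addr0.
Qed.

(* Integrates [|z - a| + (b - a) 1(z <= t) <= |z - b| + (b - a) 1(z > a)]. *)
Lemma le_integral_abs_dist (a b t : R) : a <= t -> t <= (a + b) / 2 ->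
  (\int[mu]_z (`|z - a| * h z)%:E +
     (b - a)%:E * \int[mu]_(z in `]-oo, t]) (h z)%:E <=
   \int[mu]_z (`|z - b| * h z)%:E +
     (b - a)%:E * \int[mu]_(z in `]a, +oo[) (h z)%:E)%E.
Proof.
move=> le_at le_tab; have ab : 0 <= b - a by lra.
have mA (x : R) (D : set R) : measurable D -> measurable_fun setT
    (fun z : R => (`|z - x| * h z + (b - a) * (h z * \1_D z))%:E).
  move=> mD; apply/measurable_EFinP/measurable_funD; apply: measurable_funM => //.
    by apply: measurableT_comp => //; exact: measurable_funB.
  by apply: measurable_funM => //; exact: measurable_indic.
have A0 x (D : set R) z : 0 <= `|z - x| * h z + (b - a) * (h z * \1_D z).
  by rewrite addr_ge0// mulr_ge0// mulr_ge0.
have AE (x : R) (D : set R) : measurable D ->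
  (\int[mu]_z (`|z - x| * h z)%:E + (b - a)%:E * \int[mu]_(z in D) (h z)%:E =
   \int[mu]_z (`|z - x| * h z + (b - a) * (h z * \1_D z))%:E)%E.
  move=> mD; have mI : measurable_fun setT (fun z : R => (h z * \1_D z)%:E).
    by apply/measurable_EFinP/measurable_funM => //; exact: measurable_indic.
  rewrite integral_EFin_indic// -ge0_integralZl//; last first.
    by move=> z _; rewrite lee_fin mulr_ge0.
  rewrite -ge0_integralD//.
  - by move=> z _; rewrite lee_fin mulr_ge0.
  - apply/measurable_EFinP/measurable_funM => //.
    by apply: measurableT_comp => //; exact: measurable_funB.
  - by move=> z _; rewrite mule_ge0// lee_fin mulr_ge0.
  - exact: measurable_funeM.
rewrite !AE//; apply: ge0_le_integral => //.
- by move=> z _; rewrite lee_fin.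
- exact: mA.
- exact: mA.
move=> z _; rewrite lee_fin !(mulrCA (b - a)) ![_ * h z]mulrC.
rewrite -!mulrDr ler_wpM2l// !indicE !mem_setE !in_itv/= andbT.
by case: (lerP z t) => ?; case: (ltrP a z) => ?;
  case: (ler0P (z - a)) => ?; case: (ler0P (z - b)) => ? /=; lra.
Qed.

(** Take [t = a] in [le_integral_abs_dist] and cancel the half masses. The left one is finite
    whenever the integral at [b] is, because [b - a <= |z - b|] for [z <= a]; if the integral at [b]
    is infinite, the bound is trivial. *)
Lemma integral_abs_dist_le (a b : R) : a < b ->
  (\int[mu]_(z in `]a, +oo[) (h z)%:E <= \int[mu]_(z in `]-oo, a]) (h z)%:E)%E ->
  (\int[mu]_z (`|z - a| * h z)%:E <= \int[mu]_z (`|z - b| * h z)%:E)%E.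
Proof.
move=> ab Ha.
have mA (x : R) : measurable_fun setT (fun z : R => (`|z - x| * h z)%:E).
  apply/measurable_EFinP/measurable_funM => //.
  by apply: measurableT_comp => //; exact: measurable_funB.
have := @le_integral_abs_dist a b a (lexx a).
have -> : (a <= (a + b) / 2) = true by lra.
move=> /(_ isT) ineq.
have : ((b - a)%:E * \int[mu]_(z in `]-oo, a]) (h z)%:E <=
        \int[mu]_z (`|z - b| * h z)%:E)%E.
  rewrite -ge0_integralZl//; last 3 first.
  - by apply/measurable_funTS/measurable_EFinP.
  - by move=> z _; rewrite lee_fin.
  - by rewrite lee_fin; lra.
  apply: (@le_trans _ _ (\int[mu]_(z in `]-oo, a]) (`|z - b| * h z)%:E)%E).
    apply: ge0_le_integral => //.
    - by move=> z _; rewrite lee_fin mulr_ge0//; lra.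
    - by apply: measurable_funeM; apply/measurable_funTS/measurable_EFinP.
    - by apply: measurable_funTS; exact: mA.
    move=> z /=; rewrite in_itv/= => za; rewrite -EFinM lee_fin ler_wpM2r//.
    by rewrite ler0_norm; lra.
  apply: ge0_subset_integral => //; first exact: mA.
  by move=> z _; rewrite lee_fin mulr_ge0.
have : (0 <= \int[mu]_z (`|z - b| * h z)%:E)%E.
  by apply: integral_ge0 => z _; rewrite lee_fin mulr_ge0.
case: (\int[mu]_z (`|z - b| * h z)%:E)%E ineq => [r| |]//; last first.
  by move=> *; rewrite leey.
move=> ineq _ Hr.
have H1fin : ((b - a)%:E * \int[mu]_(z in `]-oo, a]) (h z)%:E)%E \is a fin_num.
  rewrite ge0_fin_numE ?(le_lt_trans Hr) ?ltry// mule_ge0 ?lee_fin; first by [].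
    lra.
  by apply: integral_ge0 => z _; rewrite lee_fin.
rewrite -(leeD2rE _ _ H1fin); apply: (le_trans ineq); rewrite leeD2l//.
by rewrite lee_pmul2l// lte_fin; lra.
Qed.

(** Take for [t] the midpoint of [a] and [b]. Uniqueness of the median puts positive mass between
    [a] and [t], which makes the comparison strict. *)
Lemma integral_abs_dist_lt (a b : R) : a < b ->
  bisects a -> (forall t, bisects t -> a = t) ->
  (\int[mu]_z (`|z - b| * h z)%:E < +oo)%E ->
  (\int[mu]_z (`|z - a| * h z)%:E < \int[mu]_z (`|z - b| * h z)%:E)%E.
Proof.
move=> ab bis_a uniq_a fin_b; pose t := (a + b) / 2.
have at_ : a < t by rewrite /t; lra.
have le_p_q := ge0_le_integral_itvNyc (ltW at_).
have lt_p_q : (\int[mu]_(z in `]a, +oo[) (h z)%:E <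
               \int[mu]_(z in `]-oo, t]) (h z)%:E)%E.
  case: bis_a => pE p0 py; rewrite -pE lt_neqAle le_p_q andbT.
  (* Without mass between [a] and [t], the point [t] would be a second median. *)
  apply/negP => /eqP q_eq; have /uniq_a a_eq : bisects t.
    split; [|by rewrite -q_eq|by rewrite -q_eq].
    have p_fin : (\int[mu]_(z in `]-oo, a]) (h z)%:E)%E \is a fin_num.
      by rewrite ge0_fin_numE ?ltW.
    have := ge0_integralT_split_at t.
    rewrite (ge0_integralT_split_at a) -pE -q_eq => e.
    apply/eqP; rewrite eq_le -(leeD2lE _ _ p_fin) e lexx /=.
    by rewrite -(leeD2lE _ _ p_fin) e.
  by rewrite a_eq ltxx in at_.
have := @le_integral_abs_dist a b t (ltW at_) (lexx _).
have Ib_fin : (\int[mu]_z (`|z - b| * h z)%:E)%E \is a fin_num.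
  rewrite ge0_fin_numE//.
  by apply: integral_ge0 => z _; rewrite lee_fin mulr_ge0.
rewrite !ltNge; apply: contraTN => le_ba; rewrite -ltNge.
apply: (@lt_le_trans _ _ (\int[mu]_z (`|z - b| * h z)%:E +
  (b - a)%:E * \int[mu]_(z in `]-oo, t]) (h z)%:E)%E); last exact: leeD2r.
by rewrite lteD2lE// lte_pmul2l// lte_fin; lra.
Qed.

End weighted_median.

(** * Monotone likelihood ratio and the position of the median *)

Lemma bisects_monotone_likelihood_ratio (R : realType) (k h : R -> R) (c : R) :
  measurable_fun setT k -> (forall z, 0 <= k z) ->
  measurable_fun setT h -> (forall z, 0 <= h z) ->
  (forall z1 z2, z1 < z2 -> h z2 * k z1 <= h z1 * k z2) ->
  bisects k c ->
  (\int[lebesgue_measure]_(z in `]c, +oo[) (h z)%:E <=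
   \int[lebesgue_measure]_(z in `]-oo, c]) (h z)%:E)%E.
Proof.
move=> mk k0 mh h0 hk [kE kpos kfin].
have mkE (D : set R) : measurable_fun D (EFin \o k).
  by apply/measurable_funTS/measurable_EFinP.
have mhE (D : set R) : measurable_fun D (EFin \o h).
  by apply/measurable_funTS/measurable_EFinP.
have Ih0 (D : set R) : (0 <= \int[lebesgue_measure]_(z in D) (h z)%:E)%E.
  by apply: integral_ge0 => z _; rewrite lee_fin.
have k_fin : (\int[lebesgue_measure]_(z in `]-oo, c]) (k z)%:E)%E \is a fin_num.
  by rewrite ge0_fin_numE ?ltW.
(* First integrate the ratio inequality over [z1 <= c] with [z2 > c] fixed; the integration over
   [z2] follows below. *)
have inner z2 : c < z2 ->
  ((h z2)%:E * \int[lebesgue_measure]_(z in `]-oo, c]) (k z)%:E <=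
   (\int[lebesgue_measure]_(z in `]-oo, c]) (h z)%:E) * (k z2)%:E)%E.
  move=> cz2; rewrite -ge0_integralZl//; last 3 first.
  - exact: mkE.
  - by move=> z _; rewrite lee_fin.
  - by rewrite lee_fin.
  rewrite -ge0_integralZr//; last 3 first.
  - exact: mhE.
  - by move=> z _; rewrite lee_fin.
  - by rewrite lee_fin.
  apply: ge0_le_integral => //.
  - by move=> z _; rewrite mule_ge0 ?lee_fin.
  - by apply: measurable_funeM; exact: mkE.
  - by apply: emeasurable_funM; [exact: mhE|exact: measurable_cst].
  move=> z; rewrite /= in_itv/= => zc.
  by rewrite -!EFinM lee_fin hk// (le_lt_trans zc).
(* Both sides are multiplied by half the mass of [k], taken on the left of [c] in one product and on
   the right in the other; the halves are equal, positive and finite. *)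
rewrite -(@lee_pmul2r _ _ k_fin)//.
rewrite {2}kE -ge0_integralZr//; last 3 first.
- exact: mhE.
- by move=> z _; rewrite lee_fin.
- exact: ltW.
rewrite -ge0_integralZl//; last 2 first.
- exact: mkE.
- by move=> z _; rewrite lee_fin.
apply: ge0_le_integral => //.
- by move=> z _; rewrite mule_ge0 ?lee_fin// ltW.
- by apply: emeasurable_funM; [exact: mhE|exact: measurable_cst].
- by apply: measurable_funeM; exact: mkE.
by move=> z; rewrite /= in_itv/= andbT; exact: inner.
Qed.

(** This is [MLR] at the points [z1 + l < z2 + l] with parameters [0 < l]; for [l = 0] both sides
    coincide. *)
Lemma MLR_translate (R : realType) (f : R -> R) (l z1 z2 : R) :
  MLR f -> 0 <= l -> z1 < z2 -> f (z2 + l) * f z1 <= f (z1 + l) * f z2.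
Proof.
move=> mlr; rewrite le_eqVlt => /predU1P[<- _|l0 z12]; first by rewrite !addr0 mulrC.
have := mlr (z1 + l) (z2 + l) 0 l; rewrite !subr0 !addrK ltrD2r => /(_ z12 l0).
by rewrite [f z1 * _]mulrC.
Qed.

(** Divided by [f (z - u) * f z], the two summands become [f (z - u + l) / f (z - u)] and
    [f (z + l) / f z]. Each is nonincreasing in [z] by [MLR_translate]; the inequality is kept in
    multiplied form since [f] may vanish. *)
Lemma spacing_density_MLR (R : realType) (f : R -> R) (l u z1 z2 : R) :
  MLR f -> (forall x, 0 <= f x) -> 0 <= l -> z1 < z2 ->
  spacing_density f l u z2 * (f (z1 - u) * f z1) <=
  spacing_density f l u z1 * (f (z2 - u) * f z2).
Proof.
move=> mlr f0 l0 z12; rewrite /spacing_density !mulrDl lerD//.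
  have zu : z1 - u < z2 - u by rewrite ltrD2r.
  have fz0 := mulr_ge0 (f0 z1) (f0 z2).
  by have := ler_wpM2r fz0 (MLR_translate mlr l0 zu); nra.
have fu0 := mulr_ge0 (f0 (z1 - u)) (f0 (z2 - u)).
by have := ler_wpM2r fu0 (MLR_translate mlr l0 z12); nra.
Qed.

Lemma spacing_density0 (R : realType) (f : R -> R) (u z : R) :
  spacing_density f 0 u z = 2 * (f (z - u) * f z).
Proof. by rewrite /spacing_density !addr0; ring. Qed.

Lemma measurable_spacing_density (R : realType) (f : R -> R) (l : R) :
  measurable_fun setT f ->
  measurable_fun setT (fun p : R * R => spacing_density f l p.1 p.2).
Proof.
move=> mf; have mfD (q : R * R -> R) : measurable_fun setT q ->
    measurable_fun setT (fun p => f (q p)) by exact: measurableT_comp.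
apply: measurable_funD; apply: measurable_funM; apply: mfD => //.
- by apply: measurable_funD => //; exact: measurable_funB.
- exact: measurable_funD.
- exact: measurable_funB.
Qed.

(** * Measurability of the conditional median *)

Section conditional_median.
Context {R : realType}.
Variables (f : R -> R) (c : R -> R).
Hypotheses (mf : measurable_fun setT f) (f0 : forall x, 0 <= f x).
Hypothesis cE : forall u : R, 0 < u -> unique (c0u_eq f u) (c u).

Let k u z := f (z - u) * f z.

Let mk2 : measurable_fun setT (fun p : R * R => k p.1 p.2).
Proof.
apply: measurable_funM; last exact: measurableT_comp.
by apply: measurableT_comp => //; exact: measurable_funB.
Qed.

Let mk u : measurable_fun setT (k u).
Proof. exact: (measurableT_comp mk2 (pair1_measurable u)). Qed.

Let k0 u z : 0 <= k u z. Proof. exact: mulr_ge0. Qed.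

Lemma bisects_unique u : 0 < u -> unique (bisects (k u)) (c u).
Proof.
move=> /cE[cu cuniq]; split; first by apply/bisectsP.
by move=> t /bisectsP => /(_ (mk u) (k0 u)); exact: cuniq.
Qed.

Lemma lt_conditional_median u t : 0 < u -> (c u < t) <->
  (\int[lebesgue_measure]_(z in `]t, +oo[) (k u z)%:E <
   \int[lebesgue_measure]_(z in `]-oo, t]) (k u z)%:E)%E.
Proof.
move=> u0; have [[cuE cu0 cuy] uniq_cu] := bisects_unique u0; split=> [cut|].
  rewrite ltNge; apply/negP => le_t.
  have e1 := ge0_le_integral_itvNyc (mk u) (k0 u) (ltW cut).
  have e2 := ge0_le_integral_itvoy (mk u) (k0 u) (ltW cut).
  suff /uniq_cu cu_t : bisects (k u) t by rewrite cu_t ltxx in cut.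
  split; [|exact: lt_le_trans e1|].
    by apply/eqP; rewrite eq_le le_t (le_trans e2)// -cuE.
  by rewrite (le_lt_trans le_t)// (le_lt_trans e2)// -cuE.
apply: contraPP => /negP; rewrite -leNgt => tcu; apply/negP; rewrite -leNgt.
apply: (le_trans (ge0_le_integral_itvNyc (mk u) (k0 u) tcu)).
by rewrite cuE; exact: ge0_le_integral_itvoy.
Qed.

(** For [u > 0] the sublevel sets compare two integrals, measurable in [u] by Tonelli. The default
    [c 0] makes the function agree with [c] on all of [u >= 0], the range of the spacing. *)
Lemma measurable_conditional_median :
  measurable_fun setT (fun u : R => if 0 < u then c u else c 0).
Proof.
have mI (D : set R) : measurable D -> measurable_fun setT
    (fun u : R => \int[lebesgue_measure]_(z in D) (k u z)%:E)%E.
  move=> mD; under eq_fun do rewrite integral_EFin_indic//.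
  apply: (@measurable_fun_fubini_tonelli_F _ _ _ _ R lebesgue_measure
    (fun p : R * R => (k p.1 p.2 * \1_D p.2)%:E)).
    apply/measurable_EFinP/measurable_funM => //.
    by apply: measurableT_comp => //; exact: measurable_indic.
  by move=> p; rewrite lee_fin mulr_ge0.
apply: (measurability _ (RGenInftyO.measurableE R)) => //.
move=> _ [_ [t ->] <-]; rewrite setTI.
rewrite [X in measurable X](_ : _ =
  ([set` `]0, +oo[%R] `&` [set u |
     (\int[lebesgue_measure]_(z in `]t, +oo[) (k u z)%:E <
      \int[lebesgue_measure]_(z in `]-oo, t]) (k u z)%:E)%E]) `|`
  ([set` `]-oo, 0%R]%R] `&` [set _ | c 0 < t])).
  apply: measurableU.
    by apply: measurable_lte => //; apply: measurable_funTS; exact: mI.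
  apply: measurableI => //; have [ct|ct] := pselect (c 0 < t).
    by rewrite (_ : [set _ | _] = setT)//; apply/seteqP; split.
  by rewrite (_ : [set _ | _] = set0)//; apply/seteqP; split.
apply/seteqP; split=> u /=; rewrite !in_itv/= andbT.
  case: ifPn => u0; first by move/(lt_conditional_median t u0); left.
  by right; split => //; rewrite leNgt.
case=> [[u0]|[u0 ct]]; last by rewrite (ltNge 0) u0.
by rewrite u0 => /(lt_conditional_median t u0).
Qed.

End conditional_median.

(** For measurable [E] in [D], the inequality of integrals holds over [E] and over [D] minus [E].
    Since the totals agree and are finite, it is an equality over [E]; as [E] is arbitrary, the
    functions agree almost everywhere. *)
Lemma ge0_le_eq_integral_ae_eq d (T : measurableType d) (R : realType)
    (mu : {measure set T -> \bar R}) (D : set T) (g1 g2 : T -> \bar R) :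
  measurable D -> measurable_fun D g1 -> measurable_fun D g2 ->
  (forall x, D x -> 0 <= g1 x)%E -> (forall x, D x -> g1 x <= g2 x)%E ->
  (\int[mu]_(x in D) g2 x < +oo)%E ->
  (\int[mu]_(x in D) g2 x <= \int[mu]_(x in D) g1 x)%E ->
  ae_eq mu D g1 g2.
Proof.
move=> mD mg1 mg2 g10 g12 g2y le21.
have g20 x : D x -> (0 <= g2 x)%E.
  by move=> Dx; exact: le_trans (g10 _ Dx) (g12 _ Dx).
have le_sub E : measurable E -> E `<=` D ->
    (\int[mu]_(x in E) g1 x <= \int[mu]_(x in E) g2 x)%E.
  move=> mE ED; apply: ge0_le_integral => //.
  - by move=> x /ED; exact: g10.
  - exact: measurable_funS mg1.
  - exact: measurable_funS mg2.
  - by move=> x /ED; exact: g12.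
have int1y : (\int[mu]_(x in D) g1 x < +oo)%E.
  exact: le_lt_trans (le_sub D mD (@subset_refl _ _)) g2y.
apply: integral_ae_eq => //.
  apply/integrableP; split => //.
  by under eq_integral => x /[!inE] Dx do rewrite gee0_abs ?g10//.
move=> E ED mE; apply/eqP; rewrite eq_le le_sub//=.
have mDE : measurable (D `\` E) by exact: measurableD.
have split_int (g : T -> \bar R) : measurable_fun D g ->
    (forall x, D x -> 0 <= g x)%E ->
    (\int[mu]_(x in D) g x =
     \int[mu]_(x in E) g x + \int[mu]_(x in D `\` E) g x)%E.
  move=> mg g0; rewrite -ge0_integral_setU//.
  - by rewrite setDUK.
  - by rewrite setDUK.
  - by move=> x; rewrite setDUK//; exact: g0.
  - by rewrite disj_set2E setDIK.
have I1_fin : (\int[mu]_(x in D `\` E) g1 x)%E \is a fin_num.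
  rewrite ge0_fin_numE; last by apply: integral_ge0 => x [/g10].
  apply: le_lt_trans int1y; exact: ge0_subset_integral.
rewrite -(leeD2rE _ _ I1_fin) -split_int//.
apply: le_trans le21; rewrite [leRHS]split_int// leeD2l// le_sub//.
Qed.

(** * The risk as an integral over the spacing *)

Section risk.
Context {R : realType}.
Local Notation mu := (@lebesgue_measure R).
Variable f : R -> R.
Hypothesis mf : measurable_fun setT f.
Hypothesis f0 : forall x, 0 <= f x.

Lemma spacing_density_ge0 l u z : 0 <= spacing_density f l u z.
Proof. by rewrite addr_ge0// mulr_ge0. Qed.

Lemma measurable_spacing_integral (G : R * R -> \bar R) l :
  measurable_fun setT G -> (forall p, 0 <= G p)%E ->
  measurable_fun setT (fun u : R =>
    \int[mu]_z (G (z, u) * (spacing_density f l u z)%:E))%E.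
Proof.
move=> mG G0.
apply: (@measurable_fun_fubini_tonelli_F _ _ _ _ R mu
  (fun p : R * R => G (p.2, p.1) * (spacing_density f l p.1 p.2)%:E)%E).
  apply: emeasurable_funM; last first.
    by apply/measurable_EFinP; exact: measurable_spacing_density.
  exact: measurableT_comp mG (measurable_fun_pair measurable_snd measurable_fst).
by move=> p; rewrite mule_ge0// lee_fin spacing_density_ge0.
Qed.

(* The conditional expected loss given [U = u], times the density of [U] at [u]. *)
Definition spacing_risk (m : R -> R) (l u : R) : \bar R :=
  (\int[mu]_z (`|z - m u| * spacing_density f l u z)%:E)%E.

Let mloss (m : R -> R) : measurable_fun setT m ->
  measurable_fun setT (fun p : R * R => (`|p.1 - m p.2|)%:E).
Proof.
move=> mm; apply/measurable_EFinP; apply: measurableT_comp => //.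
by apply: measurable_funB => //; exact: measurableT_comp.
Qed.

Lemma measurable_spacing_risk (m : R -> R) l : measurable_fun setT m ->
  measurable_fun setT (spacing_risk m l).
Proof.
by move=> mm; exact: (@measurable_spacing_integral _ l (mloss mm)).
Qed.

Lemma spacing_risk_ge0 m l u : (0 <= spacing_risk m l u)%E.
Proof.
by apply: integral_ge0 => z _; rewrite lee_fin mulr_ge0// spacing_density_ge0.
Qed.

(** The estimation error is [z - m u] with [z] the centred maximum and [u] the spacing, so the loss
    is a function of the pair whose density is known. *)
Lemma risk_ordmax_sub d (T : measurableType d) (P : R * R -> probability T R)
    (X1 X2 : {mfun T >-> R}) (theta : R * R) (m : R -> R) :
  is_lebesgue_density f -> location_model f P X1 X2 -> measurable_fun setT m ->
  risk P X1 X2 theta (fun x => ordmax x - m (spacing x)) =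
  (\int[mu]_(u in `]0%R, +oo[) spacing_risk m `|theta.1 - theta.2|%R u)%E.
Proof.
move=> df model mm; rewrite /risk unlock.
rewrite -(@ge0_integral_location_model _ _ _ _ P X1 X2 theta _ df model (mloss mm))//.
by apply: eq_integral => w _ /=; rewrite addrAC.
Qed.

End risk.

(** * Comparison of the conditional risks at a fixed spacing *)

Section risk_comparison.
Context {R : realType}.
Local Notation mu := (@lebesgue_measure R).
Variables (f : R -> R) (c0 : R) (c : R -> R).
Hypotheses (mf : measurable_fun setT f) (f0 : forall x, 0 <= f x).
Hypothesis cE : forall u : R, 0 < u -> unique (c0u_eq f u) (c u).

Let k u z := f (z - u) * f z.

Let mk u : measurable_fun setT (k u).
Proof.
apply: measurable_funM => //.
by apply: measurableT_comp => //; exact: measurable_funB.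
Qed.

Let k0 u z : 0 <= k u z. Proof. exact: mulr_ge0. Qed.

Lemma spacing_risk_le l u : MLR f -> 0 <= l -> 0 < u ->
  (spacing_risk f (fun u => Num.min c0 (c u)) l u <=
   spacing_risk f (fun=> c0) l u)%E.
Proof.
move=> mlr l0 u0; rewrite /spacing_risk.
case: (leP c0 (c u)) => // cu_lt.
have mh : measurable_fun setT (spacing_density f l u).
  exact: (measurableT_comp (measurable_spacing_density l mf)
    (pair1_measurable u)).
have h0 := spacing_density_ge0 f0 l u.
apply: integral_abs_dist_le => //.
apply: (bisects_monotone_likelihood_ratio (mk u) (k0 u) mh h0).
  by move=> z1 z2; exact: spacing_density_MLR.
by have [] := bisects_unique mf f0 cE u0.
Qed.

Lemma spacing_risk_lt u : 0 < u -> c u < c0 ->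
  (spacing_risk f (fun=> c0) 0 u < +oo)%E ->
  (spacing_risk f (fun u => Num.min c0 (c u)) 0 u <
   spacing_risk f (fun=> c0) 0 u)%E.
Proof.
move=> u0 cu_lt.
(* At [l = 0] the density is twice [k u]; the factor 2 is written as a sum, so that the strict
   inequality for [k u] can be added to itself. *)
have spE (m : R -> R) : spacing_risk f m 0 u =
    (\int[mu]_z (`|z - m u| * k u z)%:E + \int[mu]_z (`|z - m u| * k u z)%:E)%E.
  have mI : measurable_fun setT (fun z : R => (`|z - m u| * k u z)%:E).
    apply/measurable_EFinP/measurable_funM => //.
    by apply: measurableT_comp => //; exact: measurable_funB.
  have I0 z : setT z -> (0 <= (`|z - m u| * k u z)%:E)%E.
    by rewrite lee_fin mulr_ge0.
  rewrite -ge0_integralD//; apply: eq_integral => z _.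
  by rewrite spacing_density0 -EFinD; congr (_%:E); rewrite /k; ring.
rewrite !spE min_r ?ltW// => J_lty.
have J0 : (0 <= \int[mu]_z (`|z - c0| * k u z)%:E)%E.
  by apply: integral_ge0 => z _; rewrite lee_fin mulr_ge0.
have {}J_lty : (\int[mu]_z (`|z - c0| * k u z)%:E < +oo)%E.
  by apply: le_lt_trans J_lty; exact: leeDl.
have [bis_cu uniq_cu] := bisects_unique mf f0 cE u0.
by apply: lteD; exact: (integral_abs_dist_lt (mk u) (k0 u) cu_lt bis_cu uniq_cu).
Qed.

End risk_comparison.

(* [c u] stands for c(0,u); its values at u <= 0 are unconstrained (the event
   U = 0 is null). *)
Theorem theorem3p3 (R : realType) (d : measure_display) (T : measurableType d)
    (f : R -> R) (P : R * R -> probability T R) (X1 X2 : {mfun T >-> R})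
    (c0 : R) (c : R -> R) :
  is_lebesgue_density f ->
  location_model f P X1 X2 ->
  MLR f ->
  unique (c0_eq f) c0 ->
  (forall u : R, 0 < u -> unique (c0u_eq f u) (c u)) ->
  (forall theta : R * R,
     (risk P X1 X2 theta (delta_loc c0) < +oo)%E /\
     (risk P X1 X2 theta (delta_ST c0 c) < +oo)%E) ->
  (exists theta : R * R,
     P theta [set w | c (spacing (X1 w, X2 w)) < c0] <> 0%E) ->
  improves_upon P X1 X2 (delta_ST c0 c) (delta_loc c0).
Proof.
move=> df model mlr _ cE fin_risk [theta Ptheta].
have [mf f0 _] := df.
(* The values of [c] at negative arguments, which may destroy measurability,
   are irrelevant since the spacing is nonnegative. *)
pose c' (u : R) := if 0 < u then c u else c 0.
have mc' : measurable_fun setT c'.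
  exact: (measurable_conditional_median mf f0 cE).
have c'_spacing (x : R * R) : c' (spacing x) = c (spacing x).
  rewrite /c'; case: ltP => // /(conj (spacing_ge0 x)) /andP.
  by rewrite -eq_le => /eqP ->.
pose m' (u : R) := Num.min c0 (c' u).
have mm' : measurable_fun setT m' by exact: measurable_minr.
have m'E l u : 0 < u ->
    spacing_risk f m' l u = spacing_risk f (fun u => Num.min c0 (c u)) l u.
  by move=> u0; rewrite /spacing_risk /m' /c' u0.
have risk_ST theta' : risk P X1 X2 theta' (delta_ST c0 c) =
    (\int[lebesgue_measure]_(u in `]0%R, +oo[)
       spacing_risk f m' `|theta'.1 - theta'.2|%R u)%E.
  rewrite -(risk_ordmax_sub theta' df model mm'); congr risk.
  by apply/funext => x; rewrite /m' c'_spacing.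
have risk_loc theta' : risk P X1 X2 theta' (delta_loc c0) =
    (\int[lebesgue_measure]_(u in `]0%R, +oo[)
       spacing_risk f (fun=> c0) `|theta'.1 - theta'.2|%R u)%E.
  by rewrite -(risk_ordmax_sub theta' df model (measurable_cst c0)).
have mS (m : R -> R) (l : R) : measurable_fun setT m ->
    measurable_fun (`]0%R, +oo[ : set R) (spacing_risk f m l).
  by move=> mm; apply: measurable_funTS; exact: measurable_spacing_risk.
have le_S (l u : R) : 0 <= l -> `]0%R, +oo[%classic u ->
    (spacing_risk f m' l u <= spacing_risk f (fun=> c0) l u)%E.
  move=> l0; rewrite /= in_itv/= andbT => u0; rewrite m'E//.
  exact: spacing_risk_le.
split=> [theta'|].
  rewrite risk_ST risk_loc; apply: ge0_le_integral => //.
  - by move=> u _; exact: spacing_risk_ge0.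
  - exact: mS.
  - exact: mS.
  - by move=> u; exact: le_S.
(* Equal parameters give [l = 0], the case of [spacing_risk_lt]. If the risk did not drop strictly
   there, the event would be null under the given [theta], as is now shown. *)
exists (0, 0); rewrite ltNge; apply/negP => le_risk; apply: Ptheta.
have [fin_loc _] := fin_risk (0, 0).
move: le_risk fin_loc; rewrite risk_ST risk_loc /= subrr normr0 => le_risk fin_loc.
have S_eq : ae_eq (@lebesgue_measure R) `]0%R, +oo[%classic
    (spacing_risk f m' 0) (spacing_risk f (fun=> c0) 0).
  apply: ge0_le_eq_integral_ae_eq => //.
  - exact: mS.
  - exact: mS.
  - by move=> u _; exact: spacing_risk_ge0.
  - by move=> u; exact: le_S.
(* Finite total risk makes the conditional risk finite at almost every [u], as the strict comparison
   requires. *)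
have S_fin : {ae (@lebesgue_measure R), forall u : R, `]0%R, +oo[%classic u ->
    spacing_risk f (fun=> c0) 0 u \is a fin_num}.
  apply: integrable_ae => //; apply/integrableP; split; first exact: mS.
  by under eq_integral do rewrite gee0_abs ?spacing_risk_ge0//.
pose S := [set u : R | c' u < c0].
have mS' : measurable S.
  rewrite (_ : S = setT `&` c' @^-1` `]-oo, c0[%classic); first exact: mc'.
  by rewrite setTI; apply/seteqP; split => u /=; rewrite in_itv.
(* With this indicator of the spacing, the probability of the event becomes an integral over [u], to
   which [ge0_integral_location_model] applies for any [theta]. *)
pose G (p : R * R) : \bar R := (\1_S p.2)%:E.
have mG : measurable_fun setT G.
  apply/measurable_EFinP.
  by apply: measurableT_comp => //; exact: measurable_indic.
have G0 p : (0 <= G p)%E by rewrite lee_fin.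
pose A := [set w | c (spacing (X1 w, X2 w)) < c0].
have AE : A = (fun w => spacing (X1 w, X2 w)) @^-1` S.
  by apply/seteqP; split => w; rewrite /A /S /= c'_spacing.
have mA : measurable A.
  rewrite AE -[X in measurable X]setTI.
  have mX : measurable_fun setT (fun w => (X1 w, X2 w)).
    exact: measurable_fun_pair.
  exact: (measurableT_comp (@measurable_spacing R) mX).
transitivity (\int[P theta]_w (\1_A w)%:E)%E.
  by rewrite integral_indic// setIT.
transitivity (\int[P theta]_w
   G (ordmax (X1 w, X2 w) - ordmax theta, spacing (X1 w, X2 w))%R)%E.
  by apply: eq_integral => w _; rewrite AE.
rewrite (ge0_integral_location_model _ df model)//.
transitivity (\int[@lebesgue_measure R]_(u in `]0%R, +oo[) (cst 0%E) u)%E;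
  last by rewrite integral0.
apply: ae_eq_integral => //.
  by apply: measurable_funTS; exact: measurable_spacing_integral.
(* At almost every [u > 0] the two conditional risks at [l = 0] are equal and finite, so [u] cannot
   lie in [S]: there [spacing_risk_lt] would separate them. Hence the integrand vanishes, whatever
   the value of [l] for [theta]. *)
move: S_eq S_fin; apply: filterS2 => u S_eq S_fin u0.
rewrite /cst integral0_eq// => z _.
rewrite /G/= indicE; case: (boolP (u \in S)); last by rewrite mul0e.
rewrite inE /S /c'/=; have u0' : 0 < u by move: u0; rewrite /= in_itv/= andbT.
rewrite u0' => cu_lt; have : (spacing_risk f (fun=> c0) 0 u < +oo)%E.
  by rewrite -ge0_fin_numE ?S_fin// spacing_risk_ge0.
move/(spacing_risk_lt mf f0 cE u0' cu_lt).
by rewrite -m'E// S_eq// ltxx.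
Qed.
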